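(* Let $G_1,\ldots,G_h$ be a collection of $h>1$ graphs such that for each $1\le i\le h$, $N\le|V(G_i)|\le\gamma N$ and $G_i$ is a $\psi$-expander, for some $N\ge1$, $\gamma\ge1$ and $0<\psi\le1$. Let $H$ be a graph with vertex set $\{v_1,\ldots,v_h\}$ that is a $\psi'$-expander, and let $\Delta$ be the maximum vertex degree in $H$. Let $G$ be a graph that is an $N$-composition of $H$ with $G_1,\ldots,G_h$. Then $G$ is a $\psi''$-expander for $\psi''=\psi\psi'/(16\Delta\gamma^2)$.
   Context: Graphs are undirected and unweighted, possibly with parallel edges but no self-loops. For a graph $K=(V,E)$, the sparsity of a cut $\emptyset\neq S\subsetneq V$ is $\frac{|E_K(S,V\setminus S)|}{\min\{|S|,|V\setminus S|\}}$; $K$ is a $\psi$-expander if every cut has sparsity at least $\psi$. Given disjoint graphs $G_1,\ldots,G_h$ with vertex sets $V_i=V(G_i)$, each of cardinality at least $N$, and a graph $H$ on vertex set $\{v_1,\ldots,v_h\}$, an $N$-composition of $H$ with $G_1,\ldots,G_h$ is a graph $G$ with vertex set $\bigcup_iV_i$ whose edge set is $\bigcup_iE(G_i)$ together with, for each edge $e=(v_i,v_j)\in E(H)$, an arbitrary matching $M(e)$ of cardinality $N$ between vertices of $V_i$ and vertices of $V_j$. *)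

(* Defs.v *)
From HB Require Import structures.
From mathcomp Require Import all_boot all_order all_algebra.

Set Implicit Arguments.
Unset Strict Implicit.
Unset Printing Implicit Defensive.

Import Order.TTheory GRing.Theory Num.Theory.

Local Open Scope ring_scope.

(* Parallel edges are distinct elements of [edge] with the same [ends];
   [ends_card] makes edges unordered pairs and rules out self-loops. *)
Record mgraph (V : finType) := MGraph {
  edge : finType;
  ends : edge -> {set V};
  ends_card : forall e : edge, #|ends e| = 2%N
}.

Definition degree (V : finType) (K : mgraph V) (v : V) : nat :=
  #|[set e : edge K | v \in ends e]|.

Definition max_degree (V : finType) (K : mgraph V) : nat :=
  \max_(v : V) degree K v.

Definition cut_edges (V : finType) (K : mgraph V) (S : {set V}) :
    {set edge K} :=
  [set e : edge K | (ends e :&: S != set0) && (ends e :&: ~: S != set0)].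

Definition sparsity (R : realFieldType) (V : finType) (K : mgraph V)
    (S : {set V}) : R :=
  #|cut_edges K S|%:R / (minn #|S| #|~: S|)%:R.

Definition expander (R : realFieldType) (V : finType) (K : mgraph V)
    (psi : R) : Prop :=
  forall S : {set V}, S != set0 -> S \proper [set: V] -> psi <= sparsity R K S.

Definition matching (V : finType) (K : mgraph V) (M : {set edge K}) : Prop :=
  {in M &, forall f g, f != g -> [disjoint ends f & ends g]}.

(* The vertex set is the disjoint union {i & V i} of the V_i. The function
   [origin] splits the edges of G (with multiplicity) into a copy of each
   E(G_i) and the sets M(e), e in E(H). An edge of G joins V_i to V_j exactly
   when the set of tags of its ends is {i, j}. *)
Definition composition (N h : nat) (V : 'I_h -> finType)
    (Gs : forall i : 'I_h, mgraph (V i)) (H : mgraph 'I_h)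
    (G : mgraph {i : 'I_h & V i}) : Prop :=
  exists origin : edge G -> {i : 'I_h & edge (Gs i)} + edge H,
    (forall (i : 'I_h) (a : edge (Gs i)),
       let a' := Tagged (fun i => edge (Gs i)) a in
       exists g : edge G,
         [/\ origin g = inl a',
             forall g' : edge G, origin g' = inl a' -> g' = g
           & ends g = [set Tagged V x | x in ends a]]) /\
    (forall e : edge H,
       let M := [set g : edge G | origin g == inr e] in
       [/\ matching M, #|M| = N
         & {in M, forall g, [set tag x | x in ends g] = ends e}]).

(* Main.v *)
(** Let [I] be the set of those [i] such that [S] contains more than half of
    [V_i], and let [W] be the set of vertices lying on the minority side of [S]
    in their own block. Write [C], [D] for the numbers of edges of [G] and [H]
    cut by [S] and [I]. Expansion of the blocks gives [psi * |W| <= C]. If an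
    edge [e] of [H] is cut by [I], each uncut edge of its matching has an end in
    [W], so [N * D <= C + Delta * |W|]. Finally [S] and its complement are, up to
    [W], unions of blocks, so the smaller of them has at most
    [gamma * N * min(|I|, h - |I|) + |W|] elements, and expansion of [H] bounds
    [min(|I|, h - |I|)] by [D / psi']. Combining these with [psi' <= Delta]
    gives the theorem, even with [3 * Delta * gamma] as the denominator. *)
Require Import Defs.
From mathcomp Require Import all_boot all_order all_algebra.
From mathcomp Require Import lra.

Import Order.TTheory GRing.Theory Num.Theory.

Local Open Scope ring_scope.

Lemma card_tagged_set (I : finType) (V : I -> finType) (A : {set {i : I & V i}}) :
  #|A| = (\sum_i #|[set v : V i | Tagged V v \in A]|)%N.
Proof.
rewrite -sum1_card.
under [RHS]eq_bigr => i _ do rewrite -sum1_card.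
by rewrite sig_big_dep /=; apply: eq_bigl => -[i v]; rewrite /= inE.
Qed.

(** Double counting of the related pairs; it turns sums over cut edges of [H] into sums over edges
    of [G] or over minority vertices. *)
Lemma sum_card_fibers (T U : finType) (A : {set T}) (P : {set U})
    (r : T -> U -> bool) :
  (\sum_(u in P) #|[set x in A | r x u]| = \sum_(x in A) #|[set u in P | r x u]|)%N.
Proof.
transitivity (\sum_(u in P) \sum_(x in A) r x u)%N.
  apply: eq_bigr => u _; rewrite -sum1_card big_mkcond [RHS]big_mkcond /=.
  by apply: eq_bigr => x _; rewrite inE; case: (x \in A); case: (r x u).
rewrite exchange_big; apply: eq_bigr => x _.
rewrite -sum1_card big_mkcond [RHS]big_mkcond /=.
by apply: eq_bigr => u _; rewrite inE; case: (u \in P); case: (r x u).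
Qed.

Lemma cut_edgesP (V : finType) (K : mgraph V) (S : {set V}) (e : edge K) :
  reflect (exists x y, [/\ x \in ends e, y \in ends e, x \in S & y \notin S])
          (e \in cut_edges K S).
Proof.
rewrite inE; apply: (iffP andP) => [[/set0Pn[x] + /set0Pn[y]]|].
  by rewrite !inE => /andP[xe xS] /andP[ye yS]; exists x, y.
by move=> [x [y [xe ye xS yS]]]; split; apply/set0Pn;
   [exists x | exists y]; rewrite !inE ?xe ?ye ?xS ?yS.
Qed.

(** With the denominator cleared, the bound also covers trivial cuts, where the minimum is 0. It is
    applied to blocks and to [majority], which may be empty or full. *)
Lemma card_cut_expander (R : realFieldType) (V : finType) (K : mgraph V)
    (psi : R) (S : {set V}) :
  expander K psi -> psi * (minn #|S| #|~: S|)%:R <= #|cut_edges K S|%:R.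
Proof.
move=> Kexp; have [->|m_gt0] := posnP (minn #|S| #|~: S|).
  by rewrite mulr0 ler0n.
have := m_gt0; rewrite leq_min => /andP[S_gt0 SC_gt0].
have := Kexp S; rewrite /sparsity ler_pdivlMr ?ltr0n //; apply.
  by rewrite -card_gt0.
by rewrite properT; apply: contraTneq SC_gt0 => ->; rewrite setCT cards0.
Qed.

(** A cut isolating one vertex has smaller side 1, and all its edges meet that vertex. *)
Lemma expander_le_max_degree (R : realFieldType) (V : finType) (K : mgraph V)
    (psi : R) :
  (1 < #|V|)%N -> expander K psi -> psi <= (max_degree K)%:R.
Proof.
move=> V_gt1 Kexp; have /card_gt0P[v _] : (0 < #|V|)%N by apply: ltnW.
have := card_cut_expander _ _ _ _ [set v] Kexp.
have -> : minn #|[set v]| #|~: [set v]| = 1%N.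
  by rewrite cardsC1 cards1; apply/minn_idPl; rewrite -ltnS prednK // ltnW.
rewrite mulr1 => /le_trans; apply; rewrite ler_nat.
apply: leq_trans (leq_bigmax v); apply: subset_leq_card; apply/subsetP => e.
by case/cut_edgesP => x [y [xe _ /set1P <- _]]; rewrite inE.
Qed.

Section Composition.

Variables (N h : nat) (V : 'I_h -> finType).
Variables (Gs : forall i : 'I_h, mgraph (V i)) (H : mgraph 'I_h).
Variables (G : mgraph {i : 'I_h & V i}) (G_comp : composition N Gs H G).
Variable S : {set {i : 'I_h & V i}}.

Definition block (i : 'I_h) : {set V i} := [set v | Tagged V v \in S].

Definition majority : {set 'I_h} := [set i | (#|~: block i| < #|block i|)%N].

Definition minority : {set {i : 'I_h & V i}} :=
  [set x | (x \in S) != (tag x \in majority)].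

Lemma in_minority x : (x \in minority) = ((x \in S) != (tag x \in majority)).
Proof. exact: in_set. Qed.

Lemma card_minority : #|minority| = (\sum_i minn #|block i| #|~: block i|)%N.
Proof.
rewrite card_tagged_set; apply: eq_bigr => i _.
have [iI|iI] := boolP (i \in majority).
  have -> : [set v : V i | Tagged V v \in minority] = ~: block i.
    by apply/setP => v; rewrite in_setC in_set in_minority /= iI in_set; case: (_ \in S).
  by symmetry; apply/minn_idPr/ltnW; move: iI; rewrite inE.
have -> : [set v : V i | Tagged V v \in minority] = block i.
  by apply/setP => v; rewrite in_set in_minority /= (negbTE iI) in_set; case: (_ \in S).
by symmetry; apply/minn_idPl; move: iI; rewrite inE -leqNgt.
Qed.

(** The copy in [G] of an edge cut inside its block is cut by [S], so the image of the cut edges of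
    [G] under [origin] contains all edges cut inside blocks. *)
Lemma sum_card_cut_blocks :
  (\sum_i #|cut_edges (Gs i) (block i)| <= #|cut_edges G S|)%N.
Proof.
case: G_comp => origin [orig_in _].
pose A := [set a : {i : 'I_h & edge (Gs i)}
            | tagged a \in cut_edges (Gs (tag a)) (block (tag a))].
have -> : (\sum_i #|cut_edges (Gs i) (block i)|)%N = #|A|.
  rewrite card_tagged_set; apply: eq_bigr => i _; apply: eq_card => a.
  by rewrite [RHS]inE [RHS]inE.
rewrite -(card_imset (mem A) (@inl_inj _ (edge H))).
apply: leq_trans (leq_imset_card origin _).
apply: subset_leq_card; apply/subsetP => _ /imsetP[[i a] + ->].
rewrite inE /= => /cut_edgesP[x [y [xa ya xS yS]]].
have [g [<- _ ends_g]] := orig_in i a.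
apply: imset_f; apply/cut_edgesP; exists (Tagged V x), (Tagged V y).
by rewrite ends_g !imset_f //; move: xS yS; rewrite !inE.
Qed.

(** Each uncut edge of [M] is charged to an end in [minority]; the edges of a matching are disjoint,
    so the charge is injective. *)
Lemma card_uncut_matching (M : {set edge G}) (e : edge H) :
    matching M -> {in M, forall g, [set tag x | x in ends g] = ends e} ->
    e \in cut_edges H majority ->
  (#|M :\: cut_edges G S| <= #|[set x in minority | tag x \in ends e]|)%N.
Proof.
move=> M_match M_ends /cut_edgesP[i [j [ie je iI jI]]].
set B := M :\: _; set W := [set x in minority | _].
have end_in_W g : g \in B -> exists x, x \in ends g :&: W.
  rewrite in_setD => /andP[gS gM].
  have := ie; rewrite -(M_ends g gM) => /imsetP[x xg ix].
  have := je; rewrite -(M_ends g gM) => /imsetP[y yg jy].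
  (* The block of [x] is in [majority], that of [y] is not. If [x] is outside [S], it is a minority
     vertex; otherwise [y] is in [S] too, as [g] is uncut, and [y] is one. *)
  case xS: (x \in S); last first.
    by exists x; rewrite in_setI in_set in_minority xg -ix ie xS iI.
  exists y; rewrite in_setI in_set in_minority yg -jy je (negbTE jI) andbT /=.
  by rewrite eqbF_neg negbK; apply: contraNT gS => yS; apply/cut_edgesP; exists x, y.
(* Values in [option] avoid the need for a default vertex. *)
have [f fP] : exists f : edge G -> option {i : 'I_h & V i},
    {in B, forall g, exists2 x, f g = Some x & x \in ends g :&: W}.
  exists (fun g => [pick x in ends g :&: W]) => g /end_in_W[x xgW].
  by case: pickP => [y ygW|/(_ x)]; [exists y | rewrite xgW].
rewrite -(card_imset (mem W) (@Some_inj _)) -(@card_in_imset _ _ f B).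
  apply: subset_leq_card; apply/subsetP => _ /imsetP[g gB ->].
  by have [x ->] := fP g gB; rewrite inE => /andP[_ xW]; apply: imset_f.
move=> g g' gB g'B; have [x -> xg] := fP g gB; have [y -> yg'] := fP g' g'B.
move=> [xy]; apply/eqP; apply: contraTT isT => gg'.
have [gM g'M] : g \in M /\ g' \in M by split; [case/setDP: gB | case/setDP: g'B].
have /disjointFr := M_match g g' gM g'M gg'.
move: xg yg'; rewrite xy !inE => /andP[yg _] /andP[yg' _].
by move=> /(_ _ yg); rewrite yg'.
Qed.

Lemma matching_cut_bound :
  (N * #|cut_edges H majority|
     <= #|cut_edges G S| + max_degree H * #|minority|)%N.
Proof.
case: G_comp => origin [_ orig_M].
set D := cut_edges H majority; set C := cut_edges G S.
rewrite mulnC -sum_nat_const.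
(* The [N] edges of each matching are split into those cut by [S] and those charged to minority
   vertices. *)
apply: (@leq_trans (\sum_(e in D) (#|[set g in C | origin g == inr e]|
                     + #|[set x in minority | tag x \in ends e]|))%N).
  apply: leq_sum => e eD; have [M_match <- M_ends] := orig_M e.
  rewrite -(cardsID C); apply: leq_add; last exact: card_uncut_matching.
  by apply: subset_leq_card; apply/subsetP => g; rewrite !inE andbC.
rewrite big_split leq_add //= sum_card_fibers.
  (* An edge of [G] has a single [origin], so it counts for at most one [e]. *)
  rewrite -sum1_card; apply: leq_sum => g _.
  apply/card_le1_eqP => e e'; rewrite !inE.
  by move=> /andP[_ /eqP->] /andP[_ /eqP[]].
(* A minority vertex is charged at most once per edge of [H] at its block. *)
rewrite mulnC -sum_nat_const; apply: leq_sum => x _.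
apply: leq_trans (leq_bigmax (tag x)).
by apply: subset_leq_card; apply/subsetP => e; rewrite !inE => /andP[].
Qed.

End Composition.

(** Used for [S] with the majority blocks and for its complement with the other blocks. *)
Lemma card_le_blocks (R : realFieldType) (h : nat) (V : 'I_h -> finType) (c : R)
    (A : {set {i : 'I_h & V i}}) (I : {set 'I_h})
    (W : {set {i : 'I_h & V i}}) :
    (forall i, #|V i|%:R <= c) -> {in A, forall x, (tag x \in I) || (x \in W)} ->
  #|A|%:R <= c * #|I|%:R + #|W|%:R.
Proof.
move=> V_le A_sub; pose T := [set x : {i : 'I_h & V i} | tag x \in I].
have /(@leq_trans _ _ _) A_le : (#|A| <= #|T :|: W|)%N.
  by apply: subset_leq_card; apply/subsetP => x /A_sub; rewrite !inE.
have {A_le} : (#|A| <= #|T| + #|W|)%N by apply: A_le; rewrite cardsU leq_subr.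
rewrite -(ler_nat R) natrD => /le_trans; apply; rewrite lerD2r.
have -> : #|T| = (\sum_(i in I) #|V i|)%N.
  rewrite card_tagged_set [RHS]big_mkcond; apply: eq_bigr => i _.
  have [iI|iI] := ifPn.
    by rewrite -cardsT; apply: eq_card => v; rewrite !inE.
  by apply/eqP; rewrite cards_eq0 -subset0; apply/subsetP => v; rewrite !inE (negbTE iI).
rewrite natr_sum mulr_natr -sumr_const.
by apply: ler_sum => i _; apply: V_le.
Qed.

Theorem theorem4p4 (R : realFieldType) (h N : nat) (gamma psi psi' : R)
    (V : 'I_h -> finType) (Gs : forall i : 'I_h, mgraph (V i))
    (H : mgraph 'I_h) (G : mgraph {i : 'I_h & V i})
    (h_gt1 : (1 < h)%N) (N_ge1 : (1 <= N)%N) (gamma_ge1 : 1 <= gamma)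
    (psi_gt0 : 0 < psi) (psi_le1 : psi <= 1)
    (V_ge : forall i : 'I_h, (N <= #|V i|)%N)
    (V_le : forall i : 'I_h, #|V i|%:R <= gamma * N%:R)
    (Gs_exp : forall i : 'I_h, expander (Gs i) psi)
    (H_exp : expander H psi')
    (G_comp : composition N Gs H G) :
  expander G (psi * psi' / (16 * (max_degree H)%:R * gamma ^+ 2)).
Proof.
move=> S S_neq0 S_proper; rewrite /sparsity.
set I := majority h V S; set W := minority h V S.
have psi'_le : psi' <= (max_degree H)%:R.
  by apply: expander_le_max_degree H_exp; rewrite card_ord.
have blocks_le : psi * #|W|%:R <= #|cut_edges G S|%:R.
  have := sum_card_cut_blocks _ _ _ _ _ _ G_comp S.
  rewrite -(ler_nat R) natr_sum; apply: le_trans.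
  rewrite card_minority natr_sum mulr_sumr.
  by apply: ler_sum => i _; apply: card_cut_expander.
have H_le := card_cut_expander _ _ _ _ I H_exp.
have match_le := matching_cut_bound _ _ _ _ _ _ G_comp S.
rewrite -(ler_nat R) natrM natrD natrM -/I -/W in match_le.
have S_le : #|S|%:R <= gamma * N%:R * #|I|%:R + #|W|%:R.
  apply: card_le_blocks => // x xS.
  by rewrite in_minority xS -/I; case: (_ \in I).
have SC_le : #|~: S|%:R <= gamma * N%:R * #|~: I|%:R + #|W|%:R.
  apply: card_le_blocks => // x; rewrite in_setC in_setC in_minority -/I => /negbTE ->.
  by case: (_ \in I).
have min_le : (minn #|S| #|~: S|)%:R
    <= gamma * N%:R * (minn #|I| #|~: I|)%:R + #|W|%:R.
  have min_natr a b (c : R) : c <= a%:R -> c <= b%:R -> c <= (minn a b)%:R.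
    by move=> ca cb; rewrite /minn; case: ifP.
  have [_|_] := leqP #|I| #|~: I|.
    by apply: le_trans S_le; rewrite ler_nat geq_minl.
  by apply: le_trans SC_le; rewrite ler_nat geq_minr.
have m_gt0 : (0 < minn #|S| #|~: S|)%N.
  rewrite leq_min !card_gt0 S_neq0 /=.
  by apply: contraTneq S_proper => SC0; rewrite -(setCK S) SC0 setC0 properxx.
move: (minn #|S| _) m_gt0 min_le => m m_gt0.
move: (minn #|I| _) H_le => d H_le min_le.
rewrite ler_pdivlMr ?ltr0n //.
move: (ler0n R #|cut_edges G S|) (ler0n R #|cut_edges H I|) blocks_le match_le
  (ler0n R m) (ler0n R N) (ler0n R #|W|) H_le min_le.
move: #|cut_edges G S|%:R #|cut_edges H I|%:R m%:R N%:R #|W|%:R d%:R.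
move=> C D mR n w dR C_ge0 D_ge0 psi_w nD mR_ge0 n_ge0 w_ge0 psi_d mR_le.
(* If the maximum degree is 0, the quotient is 0 by the convention for division by zero. *)
have [Delta0|Delta_gt0] := posnP (max_degree H).
  by rewrite Delta0 mulr0 mul0r invr0 mulr0 mul0r.
have Delta_ge1 : 1 <= (max_degree H)%:R :> R by rewrite ler1n.
move: (max_degree H)%:R Delta_ge1 psi'_le nD {Delta_gt0}.
move=> Delta Delta_ge1 psi'_le nD.
have den_gt0 : 0 < 16 * Delta * gamma ^+ 2.
  by rewrite !mulr_gt0 ?exprn_gt0 ?ltr0n //; lra.
rewrite mulrAC ler_pdivrMr //.
have [psi'_le0|psi'_gt0] := leP psi' 0.
  apply: (@le_trans _ _ 0); last by rewrite mulr_ge0 // ltW.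
  by rewrite mulr_le0_ge0 // mulr_ge0_le0 // ltW.
have gamma_ge0 : 0 <= gamma by lra.
(* The nonlinear products are prepared here so that [lra] can treat monomials as atoms. Steps 1 to 9
   give the bound [3 * gamma * Delta * C]; steps 10 and 11 weaken it to the factor
   [16 * gamma ^+ 2]. *)
have step1 : psi * psi' * mR <= psi * psi' * (gamma * n * dR + w).
  by rewrite ler_wpM2l // mulr_ge0 // ltW.
have step2 : gamma * n * psi * (psi' * dR) <= gamma * n * psi * D.
  by rewrite ler_wpM2l // !mulr_ge0 // ltW.
have step3 : gamma * psi * (n * D) <= gamma * psi * (C + Delta * w).
  by rewrite ler_wpM2l // mulr_ge0 // ltW.
have step4 : gamma * Delta * (psi * w) <= gamma * Delta * C.
  by rewrite ler_wpM2l // mulr_ge0 //; lra.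
have step5 : psi' * (psi * w) <= psi' * C by rewrite ler_wpM2l // ltW.
have step6 : psi' * C <= Delta * C by rewrite ler_wpM2r.
have step7 : psi * (gamma * C) <= 1 * (gamma * C) by rewrite ler_wpM2r // mulr_ge0.
have step8 : 1 * (gamma * C) <= Delta * (gamma * C) by rewrite ler_wpM2r // mulr_ge0.
have step9 : 1 * (Delta * C) <= gamma * (Delta * C).
  by rewrite ler_wpM2r // mulr_ge0 //; lra.
have step10 : 1 * (gamma * Delta * C) <= gamma * (gamma * Delta * C).
  by rewrite ler_wpM2r // !mulr_ge0 //; lra.
have step11 : 0 <= gamma * Delta * C by rewrite !mulr_ge0 //; lra.
lra.
Qed.
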